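(* For every odd integer $m\ge 3$, setting $n=3m$, there is a graph $G$ on $n$ vertices with minimum degree $\delta(G)=\frac{2}{3}n-1$ for which $\mathcal{H}_G$ is not $2$-switch irreducible.
   Context: Graphs are finite, simple and undirected. $\mathcal{H}_G$ is the set of all Hamiltonian cycles of $G$, viewed as spanning subgraphs. A switch of size $j$ transforms some $H\in\mathcal{H}_G$ into some $H'\in\mathcal{H}_G$ by removing exactly $j$ edges of $H$ and adding exactly $j$ edges not in $H$; a $k$-switch is a switch of size at most $k$. $\mathcal{H}_G$ is $k$-switch irreducible if for all $H_1,H_2\in\mathcal{H}_G$ there is a sequence $H_1=Z_1,\dots,Z_q=H_2$ of elements of $\mathcal{H}_G$ such that every consecutive pair $(Z_i,Z_{i+1})$ differs by a $k$-switch. *)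

(* Defs.v *)
From mathcomp Require Import all_boot all_order all_algebra.

Set Implicit Arguments.
Unset Strict Implicit.
Unset Printing Implicit Defensive.

Record sgraph (T : finType) := SGraph {
  adj :> rel T;
  adj_sym : symmetric adj;
  adj_irrefl : irreflexive adj }.

Definition degree (T : finType) (G : sgraph T) (x : T) : nat :=
  #|[set y | adj G x y]|.

(* Every degree is less than #|T|, so the default value #|T| only shows when
   T is empty. *)
Definition min_degree (T : finType) (G : sgraph T) : nat :=
  \big[minn/#|T|]_(x : T) degree G x.

(* An edge is an unordered pair [set x; y], and a spanning subgraph is
   represented by its edge set, of type {set {set T}}. *)
Definition cycle_edges (T : finType) (s : seq T) : {set {set T}} :=
  [set [set x; next s x] | x in s].

(* ucycleb (adj G) s: s is duplicate-free and consecutive vertices, cyclically,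
   are adjacent. It also holds of a single edge on two vertices and of the empty
   sequence, hence the requirement 2 < #|T|. *)
Definition ham_cycles (T : finType) (G : sgraph T) : {set {set {set T}}} :=
  [set cycle_edges (tval s) | s : #|T|.-tuple T
     & (2 < #|T|) && ucycleb (adj G) s].

Definition switch_of_size (T : finType) (j : nat) (H H' : {set {set T}}) : bool :=
  (#|H :\: H'| == j) && (#|H' :\: H| == j).

Definition k_switch (T : finType) (k : nat) (H H' : {set {set T}}) : bool :=
  [exists j : 'I_k.+1, switch_of_size j H H'].

(* The sequence Z_1, ..., Z_q of the definition is H1 :: Z. *)
Definition k_switch_irreducible (T : finType) (G : sgraph T) (k : nat) : Prop :=
  forall H1 H2 : {set {set T}}, H1 \in ham_cycles G -> H2 \in ham_cycles G ->
  exists Z : seq {set {set T}},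
    [/\ {subset H1 :: Z <= ham_cycles G}, path (k_switch k) H1 Z
      & last H1 Z = H2].

(* Main.v *)
Require Import Defs.
From mathcomp Require Import all_boot all_order all_algebra.
From mathcomp Require Import zify ring.

(** The graph joins every vertex of an independent set I of size m + 1 to every
    vertex of two disjoint cliques K1 and K2, of sizes m - 1 and m, with no
    edge between K1 and K2.  Vertices of I and of K1 have degree 2m - 1 and
    those of K2 have degree 2m.

    The number of edges of a Hamiltonian cycle inside K1 is invariant under
    2-switches ([two_switch_inner]).  Indeed, the sum of the degrees over K1,
    over K2 and over I is the same in all Hamiltonian cycles
    ([ham_cycle_degree_sum]).  Hence the edges inside K1 and K2 have a constant
    total, and a switch that increases the number inside K1 removes an edge
    inside K2.  In order to keep the degree sum over K1 it must also remove two
    edges between K1 and I, so that it removes at least three edges.  A switch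
    that decreases the number inside K1 is the reverse of such a switch.

    Both values m - 2 and m - 3 of the invariant occur.  The second cycle is
    obtained from the first by exchanging two pairs of consecutive vertices
    ([swap]), after which a vertex of I separates two vertices of K1 that were
    adjacent in the first cycle, and two vertices of K2 are consecutive. *)

Set Implicit Arguments.
Unset Strict Implicit.
Unset Printing Implicit Defensive.

(** * Degree sums along a Hamiltonian cycle *)

Section CycleEdges.
Variable T : finType.
Implicit Types (s : seq T) (x y : T) (A : {set T}).

Lemma next_next_neq s x :
  uniq s -> 2 < size s -> x \in s -> next s (next s x) != x.
Proof.
move=> Us s3 xs; have [i t Es] := rot_to xs.
have Ut : uniq (rot i s) by rewrite rot_uniq.
have st : 2 < size (rot i s) by rewrite size_rot.
rewrite -!(next_rot i Us) {}Es in Ut st *.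
case: t Ut st => [|y [|z t]] //.
rewrite [uniq _]/= !inE !negb_or => /and4P[/and3P[xy xz _] _ _ _] _.
have -> : next [:: x, y, z & t] x = y by rewrite /= eqxx.
by rewrite /= [y == x]eq_sym (negPf xy) eqxx eq_sym.
Qed.

(** Two vertices giving the same edge would be successors of each other, so the
    cycle would have length 2. *)
Lemma cycle_edge_inj s :
  uniq s -> 2 < size s -> {in s &, injective (fun x => [set x; next s x])}.
Proof.
move=> Us s3 x y xs ys /= exy; apply/eqP/negPn/negP => nxy.
have /set2P[/eqP|x_ny] : x \in [set y; next s y] by rewrite -exy set21.
  by rewrite (negPf nxy).
have /set2P[/eqP|y_nx] : y \in [set x; next s x] by rewrite exy set21.
  by rewrite eq_sym (negPf nxy).
by move: (next_next_neq Us s3 xs); rewrite -y_nx -x_ny eqxx.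
Qed.

Lemma sum_cycle_edges s (F : {set T} -> nat) :
  uniq s -> 2 < size s -> s =i T ->
  \sum_(e in cycle_edges s) F e = \sum_(x : T) F [set x; next s x].
Proof.
move=> Us s3 sT; rewrite big_imset /=; last exact: cycle_edge_inj.
by apply: eq_bigl => x; rewrite sT.
Qed.

Lemma card_pairI x y A :
  x != y -> #|[set x; y] :&: A| = (x \in A) + (y \in A).
Proof.
move=> nxy; rewrite setIUl cardsU.
have cI z : #|[set z] :&: A| = (z \in A).
  case: (boolP (z \in A)) => zA; first by rewrite (setIidPl _) ?sub1set ?cards1.
  by apply/eqP; rewrite cards_eq0 setI_eq0 disjoints1.
rewrite !cI setIACA (_ : [set x] :&: [set y] = set0) ?set0I ?cards0 ?subn0 //.
by apply/eqP; rewrite setI_eq0 disjoints1 inE.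
Qed.

(** Each vertex lies on two edges of the cycle: as [next s] is a permutation, the
    first and the second ends of the edges each run once through A. *)
Lemma ham_cycle_degree_sum (G : sgraph T) (H : {set {set T}}) A :
  H \in ham_cycles G -> \sum_(e in H) #|e :&: A| = 2 * #|A|.
Proof.
case/imsetP=> s; rewrite inE => /and3P[n3 Cs Us] ->.
have ss : size s = #|T| by rewrite size_tuple.
have sT : s =i T.
  by apply/subset_cardP; [rewrite (card_uniqP Us) | apply/subsetP].
rewrite sum_cycle_edges ?ss //.
transitivity (\sum_(x : T) ((x \in A) + (next s x \in A))).
  apply: eq_bigr => x _; apply: card_pairI; apply/negP => /eqP nx.
  by have := next_cycle Cs (sT x); rewrite -nx adj_irrefl.
have cA : \sum_(x : T) (x \in A) = #|A|.
  by rewrite -sum1_card [RHS]big_mkcond; apply: eq_bigr => x _; case: ifP.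
rewrite big_split /= cA mul2n -addnn; congr (_ + _).
by rewrite -[RHS]cA [RHS](reindex_inj (can_inj (prev_next Us))).
Qed.

Lemma ham_cycle_edgeP (G : sgraph T) (H : {set {set T}}) e :
  H \in ham_cycles G -> e \in H -> exists x y, G x y /\ e = [set x; y].
Proof.
case/imsetP=> s; rewrite inE => /and3P[n3 Cs Us] ->.
by case/imsetP=> x xs ->; exists x, (next s x); split; first exact: next_cycle.
Qed.

End CycleEdges.

(** * Two cliques joined to an independent set *)

Section CliquesJoin.
Variables (T : finType) (c : T -> option bool).

(** A vertex is coloured [Some b] in the clique b and [None] in the independent
    set. *)
Definition linked (a b : option bool) : bool :=
  match a, b with
  | Some a', Some b' => a' == b'
  | None, None => false
  | _, _ => true
  end.

Definition cliques_join_rel : rel T := fun x y => (x != y) && linked (c x) (c y).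

Lemma cliques_join_sym : symmetric cliques_join_rel.
Proof.
move=> x y; rewrite /cliques_join_rel eq_sym; congr (_ && _).
by case: (c x) (c y) => [[]|] [[]|].
Qed.

Lemma cliques_join_irrefl : irreflexive cliques_join_rel.
Proof. by move=> x; rewrite /cliques_join_rel eqxx. Qed.

Definition cliques_join := SGraph cliques_join_sym cliques_join_irrefl.

Definition part (a : option bool) : {set T} := [set x | c x == a].

Definition inner (b : bool) (F : {set {set T}}) : nat :=
  \sum_(e in F) (e \subset part (Some b)).

Definition weight (b : bool) (F : {set {set T}}) : nat :=
  \sum_(e in F) #|e :&: part (Some b)|.

(** An edge inside a clique contributes 2 to the weight of that clique and every
    other edge meets exactly one clique, in one vertex; so the total weight is
    the number of edges plus the number of inner edges. *)
Lemma inner_weight (F : {set {set T}}) :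
  (forall e, e \in F -> exists x y, cliques_join x y /\ e = [set x; y]) ->
  [/\ 2 * inner true F <= weight true F, 2 * inner false F <= weight false F
    & weight true F + weight false F = #|F| + (inner true F + inner false F)].
Proof.
move=> FG; rewrite /inner /weight !big_distrr /=; split.
- apply: leq_sum => e /FG[x [y [/andP[nxy _] ->]]].
  rewrite card_pairI // subUset !sub1set.
  by case: (x \in _); case: (y \in _).
- apply: leq_sum => e /FG[x [y [/andP[nxy _] ->]]].
  rewrite card_pairI // subUset !sub1set.
  by case: (x \in _); case: (y \in _).
rewrite -sum1_card -!big_split /=.
apply: eq_bigr => e /FG[x [y [/andP[nxy cxy] ->]]].
rewrite !card_pairI // !subUset !sub1set !inE.
by case: (c x) (c y) cxy => [[]|] [[]|].
Qed.

(** The removed and the added edges have the same weight on each clique, and are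
    equally many, so they have equally many inner edges in total.  If the added
    ones have more inner edges in the clique [true], then the removed ones
    have weight at least 2 beyond what their own inner edges there account
    for, which takes two edges leaving that clique, and a third one inside the
    clique [false].  In the other case removed and added edges exchange
    roles. *)
Lemma two_switch_inner (H H' : {set {set T}}) :
  H \in ham_cycles cliques_join -> H' \in ham_cycles cliques_join ->
  k_switch 2 H H' -> inner true H' = inner true H.
Proof.
move=> hH hH' /existsP[j /andP[/eqP cD /eqP cD']].
have j2 : j <= 2 by rewrite -ltnS.
have edgesD X Y e : X \in ham_cycles cliques_join -> e \in X :\: Y ->
    exists x y, cliques_join x y /\ e = [set x; y].
  by move=> hX /setDP[eX _]; apply: ham_cycle_edgeP eX.
have [t1 t2 t3] := inner_weight (fun e => edgesD H H' e hH).
have [u1 u2 u3] := inner_weight (fun e => edgesD H' H e hH').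
(* The edges common to both cycles contribute equally to both degree sums. *)
have W b : weight b (H :\: H') = weight b (H' :\: H).
  have := ham_cycle_degree_sum (part (Some b)) hH.
  rewrite -(ham_cycle_degree_sum (part (Some b)) hH').
  by rewrite (big_setID H') (big_setID H (A := H')) setIC /= => /addnI.
have := W true; have := W false.
have -> : inner true H = inner true (H :&: H') + inner true (H :\: H').
  by rewrite /inner (big_setID H').
have -> : inner true H' = inner true (H :&: H') + inner true (H' :\: H).
  by rewrite /inner (big_setID H) setIC.
lia.
Qed.

Lemma two_switch_path_inner (H : {set {set T}}) (Z : seq {set {set T}}) :
  {subset H :: Z <= ham_cycles cliques_join} -> path (k_switch 2) H Z ->
  inner true (last H Z) = inner true H.
Proof.
elim: Z H => [//|H' Z IH] H sub /= /andP[sw pZ].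
rewrite (IH H') //; last by move=> X XZ; apply: sub; rewrite inE XZ orbT.
by apply: two_switch_inner => //; apply: sub; rewrite !inE eqxx ?orbT.
Qed.

Lemma degree_cliques_join x :
  degree cliques_join x =
  if c x is Some b then (#|part (Some b)| + #|part None|).-1
  else #|part (Some true)| + #|part (Some false)|.
Proof.
have disj a b : a != b -> #|part a :|: part b| = #|part a| + #|part b|.
  move=> nab; apply/eqP; rewrite (leq_card_setU _ _).
  rewrite disjoint_subset; apply/subsetP=> y; rewrite !inE => /eqP->.
  by [].
rewrite /degree; case cx: (c x) => [b|]; last first.
  rewrite -disj //; apply: eq_card => y; rewrite !inE /= /cliques_join_rel.
  case: eqVneq => [<-|_]; rewrite ?cx //=.
  by case: (c y) => [[]|].
rewrite -disj // [in RHS](cardsD1 x) !inE cx eqxx /=; apply: eq_card => y.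
rewrite !inE /= /cliques_join_rel cx [y == x]eq_sym; congr (_ && _).
by case: (c y) => [[]|]; case: b {cx}.
Qed.

End CliquesJoin.

Lemma cliques_join_ham_cycle (T : finType) (c : T -> option bool) (s : seq T) :
  2 < #|T| -> uniq s -> size s = #|T| ->
  (forall x, cliques_join c x (next s x)) ->
  cycle_edges s \in ham_cycles (cliques_join c).
Proof.
move=> T3 Us ss adj_next; apply/imsetP.
exists (tcast ss (in_tuple s)); last by rewrite val_tcast.
by rewrite inE val_tcast T3 /ucycleb Us andbT; apply: cycle_from_next.
Qed.

Lemma min_degree_attained (T : finType) (G : sgraph T) (d : nat) (x : T) :
  degree G x = d -> (forall y, d <= degree G y) -> min_degree G = d.
Proof.
move=> dx dmin; apply/eqP; rewrite eqn_leq /min_degree; apply/andP; split.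
  rewrite -dx; have : x \in index_enum T by rewrite mem_index_enum.
  elim: (index_enum T) => [//|y r IH]; rewrite inE big_cons.
  by case/predU1P=> [->|/IH]; [apply: geq_minl | apply: leq_trans; apply: geq_minr].
apply: (big_ind (fun k => d <= k)) => [|k l dk dl|y _]; last exact: dmin.
  by rewrite -dx; apply: max_card.
by rewrite leq_min dk.
Qed.

(** * The cyclic order of the ordinals *)

Definition succ_mod (n i : nat) : nat := if i.+1 == n then 0 else i.+1.

Lemma val_next_enum n (i : 'I_n) :
  next (enum 'I_n) i = succ_mod n i :> nat.
Proof.
rewrite /succ_mod next_nth mem_enum index_enum_ord.
case En: (enum 'I_n) => [|x p]; first by have := mem_enum 'I_n i; rewrite En.
have x0 : x = 0 :> nat.
  by have := nth_enum_ord i (leq_ltn_trans (leq0n i) (ltn_ord i)); rewrite En.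
rewrite -[nth x p i]/(nth x (x :: p) i.+1) -En.
case: eqP => [i_n|/eqP i_n].
  by rewrite nth_default // size_enum_ord i_n.
by rewrite nth_enum_ord // ltn_neqAle i_n ltn_ord.
Qed.

(** * The vertex classes and the two cycles *)

(** The classes are laid out along the cycle 0, 1, ..., 3m - 1.  Vertices 0
    and 1 lie in the first clique, then the 2m + 1 vertices from 2 to 2m + 2
    alternate between the independent set (even, m + 1 of them) and the second
    clique (odd, m of them), and the m - 3 remaining vertices return to the
    first clique. *)
Definition kind (m i : nat) : option bool :=
  if (i < 2) || (2 * m + 2 < i) then Some true
  else if odd i then Some false else None.

Lemma card_kind m (a : option bool) : 2 < m ->
  #|part (fun i : 'I_(3 * m) => kind m i) a| =
  match a with Some true => m.-1 | Some false => m | None => m.+1 end.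
Proof.
move=> m3.
rewrite -sum1dep_card big_mkcond /= -(big_mkord predT (fun i => if kind m i == a then 1 else 0)).
rewrite (@big_cat_nat _ _ _ 2) //=; last by lia.
rewrite (@big_cat_nat _ _ _ (2 * m + 3) 2) //=; [|lia|lia].
(* The three ranges on which the definition of kind is uniform. *)
have -> : \sum_(0 <= i < 2) (if kind m i == a then 1 else 0) = (a == Some true) * 2.
  by rewrite !big_nat_recr ?big_geq //= /kind /=; case: a => [[]|].
have -> : \sum_(2 * m + 3 <= i < 3 * m) (if kind m i == a then 1 else 0)
    = (a == Some true) * (m - 3).
  rewrite (eq_big_nat _ _ (F2 := fun=> nat_of_bool (a == Some true))); last first.
    move=> i i_hi; rewrite /kind (_ : 2 * m + 2 < i) ?orbT; last by lia.
    by rewrite eq_sym; case: (a == _).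
  rewrite sum_nat_const_nat mulnC; congr (_ * _); lia.
have -> : \sum_(2 <= i < 2 * m + 3) (if kind m i == a then 1 else 0)
    = \sum_(2 <= i < 2 * m + 3) (a == if odd i then Some false else None).
  apply: eq_big_nat => i i_mid; rewrite /kind (_ : _ || _ = false); last by lia.
  by rewrite eq_sym; case: (a == _).
have -> k : \sum_(2 <= i < 2 * k + 3) (a == if odd i then Some false else None)
    = (a == Some false) * k + (a == None) * k.+1.
  elim: k => [|k IH]; first by rewrite big_nat1 /=; case: a => [[]|].
  rewrite (_ : 2 * k.+1 + 3 = (2 * k + 3).+2); last by lia.
  rewrite !big_nat_recr /=; [|lia|lia].
  rewrite IH oddD oddM /= {IH}; case: a => [[]|] /=; lia.
case: a => [[]|] /=; lia.
Qed.

(** Relabelling by swap turns the cycle 0, 1, 2, 3, 4, 5, ... into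
    0, 2, 1, 4, 3, 5, ...: the vertex 2 of the independent set splits the pair
    0, 1 of the first clique, while 3 and 5, both in the second clique, become
    consecutive. *)
Definition swap (i : nat) : nat :=
  match i with 1 => 2 | 2 => 1 | 3 => 4 | 4 => 3 | _ => i end.

Lemma swapK : involutive swap.
Proof. by case=> [|[|[|[|[|i]]]]]. Qed.

Lemma swap_lt n i : 5 <= n -> i < n -> swap i < n.
Proof. by case: i => [|[|[|[|[|i]]]]] //= n5 _; apply: leq_trans n5. Qed.

Lemma kind_next m i : 2 < m -> i < 3 * m ->
  linked (kind m i) (kind m (succ_mod (3 * m) i)).
Proof.
move=> m3 i_n; rewrite /succ_mod; case: eqP => [i_last|i_last].
  rewrite {2}/kind /=; rewrite /kind.
  by do 2 ?[case: ifP => /= ?] => //; lia.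
by rewrite /kind /=; do 4 ?[case: ifP => /= ?] => //; lia.
Qed.

Lemma kind_swap_next m i : 2 < m -> i < 3 * m ->
  linked (kind m (swap i)) (kind m (swap (succ_mod (3 * m) i))).
Proof.
move=> m3 i_n; case: (ltnP 4 i) => [i5|i4].
  have := kind_next m3 i_n; rewrite /succ_mod; case: eqP => _;
    by case: i i5 {i_n} => [|[|[|[|[|i]]]]].
rewrite /succ_mod ifN; last by lia.
by rewrite /kind; case: i i4 {i_n} => [|[|[|[|[|i]]]]] //= _; do ?[case: ifP => /= ?] => //; lia.
Qed.

(** This compares the two cycles position by position, so that the relabelled
    one has at most as many edges inside the first clique.  It has fewer, since
    at position 0 the edge between 0 and 1 becomes one between 0 and 2. *)
Lemma swap_inner_edge m i : 2 < m -> i < 3 * m ->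
  kind m (swap i) = Some true -> kind m (swap (succ_mod (3 * m) i)) = Some true ->
  kind m i = Some true /\ kind m (succ_mod (3 * m) i) = Some true.
Proof.
move=> m3 i_n; rewrite /succ_mod; case: (ltnP 4 i) => [i5|i4].
  by case: eqP => _; case: i i5 {i_n} => [|[|[|[|[|i]]]]].
rewrite ifN; last by lia.
by rewrite /kind; case: i i4 {i_n} => [|[|[|[|[|i]]]]] //= _; do ?[case: ifP => /= ?] => //; lia.
Qed.

(** * Two Hamiltonian cycles not joined by 2-switches *)

Theorem mainTheorem4 (m n : nat) (m_odd : odd m) (m_ge3 : 3 <= m)
  (n_def : n = 3 * m) :
  exists G : sgraph 'I_n,
    ((min_degree G)%:R = 2%:R / 3%:R * n%:R - 1 :> rat)%R /\
    ~ k_switch_irreducible G 2.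
Proof.
subst n; set n := 3 * m; have n9 : 9 <= n by rewrite /n; lia.
pose c (i : 'I_n) := kind m i; exists (cliques_join c); split.
  have -> : min_degree (cliques_join c) = 2 * m - 1.
    have n0 : 0 < n by lia.
    apply: (min_degree_attained (x := Ordinal n0)) => [|i];
      rewrite degree_cliques_join.
      by rewrite {1}/c /kind /= !card_kind //; lia.
    by case: (c i) => [[]|]; rewrite !card_kind //; lia.
  rewrite GRing.natrB; last by lia.
  by rewrite /n !GRing.natrM; field.
pose p (i : 'I_n) : 'I_n := insubd i (swap i).
have val_p i : p i = swap i :> nat.
  by rewrite /p val_insubd swap_lt // (leq_trans _ n9).
have p_inj : injective p.
  by move=> i j /(congr1 val); rewrite /= !val_p => /(can_inj swapK)/val_inj.
pose s := enum 'I_n; pose s' := map p s.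
have Us : uniq s := enum_uniq 'I_n.
have Us' : uniq s' by rewrite map_inj_uniq.
have ss : size s = #|'I_n| by rewrite -cardT.
have ss' : size s' = #|'I_n| by rewrite size_map.
have n3 : 2 < #|'I_n| by rewrite card_ord; lia.
have next_s i : next s i = succ_mod n i :> nat by apply: val_next_enum.
have next_s' i : next s' (p i) = p (next s i) by apply: next_map.
have succ_neq i : i != next s i.
  by rewrite -val_eqE /= next_s /succ_mod; case: ifP => ?; lia.
have hs : cycle_edges s \in ham_cycles (cliques_join c).
  apply: cliques_join_ham_cycle => // i; apply/andP; split=> //.
  by rewrite /c next_s kind_next.
have p_surj x : exists i, x = p i.
  by exists (p x); apply: val_inj; rewrite /= !val_p swapK.
have hs' : cycle_edges s' \in ham_cycles (cliques_join c).
  apply: cliques_join_ham_cycle => // x; have [i ->] := p_surj x.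
  rewrite next_s'; apply/andP; split; first by rewrite (inj_eq p_inj).
  by rewrite /c !val_p next_s kind_swap_next.
move=> irr; have [Z [subZ pZ lastZ]] := irr _ _ hs hs'.
have := two_switch_path_inner subZ pZ; rewrite lastZ => /eqP.
apply/negP; rewrite neq_ltn; apply/orP; left.
(* Both counts become sums over positions along the cycles; they are compared
   position by position, strictly at position 0. *)
have sT (t : seq 'I_n) : uniq t -> size t = #|'I_n| -> t =i 'I_n.
  by move=> Ut st; apply/subset_cardP; [rewrite (card_uniqP Ut) | apply/subsetP].
rewrite /inner !sum_cycle_edges ?ss ?ss' //; [|exact: sT|exact: sT].
rewrite (reindex_inj p_inj) /=.
have n0 : 0 < n by lia.
rewrite (bigD1 (Ordinal n0)) //= [X in _ < X](bigD1 (Ordinal n0)) //= -addSn.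
apply: leq_add; last apply: leq_sum => i _.
  rewrite next_s' !subUset !sub1set !inE /c !val_p !next_s.
  rewrite (_ : succ_mod n (Ordinal n0) = 1); last first.
    by rewrite /succ_mod /= ifN //; lia.
  by rewrite /kind /= ifN //; lia.
rewrite next_s' !subUset !sub1set !inE /c !val_p !next_s.
case: andP => // -[/eqP k1 /eqP k2].
by have [-> ->] := swap_inner_edge m_ge3 (ltn_ord i) k1 k2; rewrite eqxx.
Qed.
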